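(* Let $(\mathfrak{g},\langle\cdot,\cdot\rangle)$ be a pseudo-Riemannian almost-abelian Lie algebra of dimension $n$ admitting a non-degenerate abelian ideal $\mathfrak{a}$ of codimension one. Let $(p,q)$ be the signature of $\langle\cdot,\cdot\rangle|_{\mathfrak{a}\times\mathfrak{a}}$ and let $e$ be a unit generator of $\mathfrak{a}^{\perp}$ (so $\langle e,e\rangle\in\{1,-1\}$). Suppose that $\operatorname{ad}_e$ is a skew-symmetric linear map with respect to $\langle\cdot,\cdot\rangle$. Then the symmetric part $U$ of the Levi-Civita connection defines an associative product on $\mathfrak{g}$ if and only if $(\mathfrak{g},\langle\cdot,\cdot\rangle)$ is isometrically isomorphic to a direct product $$(\mathbb{R}e\ltimes_{D_\beta}\mathbb{T}W,\langle\cdot,\cdot\rangle_1)\times(\mathbb{R}^{n-4k-1},\langle\cdot,\cdot\rangle_2),$$ where: (1) $W$ is a real vector space of dimension $2k$ with $2k\le\min\{p,q\}$; (2) $D_\beta$ is an infinitesimal $\beta$-transformation of $\mathbb{T}W=W\oplus W^*$ with $\beta$ a non-degenerate bivector; (3) $\langle\cdot,\cdot\rangle_1$ is a metric such that $\langle e,e\rangle_1=\pm1$ (for one of the two signs), $e$ is orthogonal to $\mathbb{T}W$, and the restriction $\langle\cdot,\cdot\rangle_1|_{\mathbb{T}W\times\mathbb{T}W}$ is the canonical neutral metric of $\mathbb{T}W$; (4) $\mathbb{R}^{n-4k-1}$ is regarded as an abelian Lie algebra endowed with a non-degenerate metric $\langle\cdot,\cdot\rangle_2$ such that the total signature of the product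 is the signature of $\langle\cdot,\cdot\rangle$.
   Context: A pseudo-Riemannian Lie algebra $(\mathfrak{g},\langle\cdot,\cdot\rangle)$ is a finite-dimensional real Lie algebra $\mathfrak{g}$ with a nondegenerate symmetric bilinear form $\langle\cdot,\cdot\rangle$ (of arbitrary signature). An almost-abelian Lie algebra is a non-abelian Lie algebra containing an abelian ideal of codimension one. A subspace is non-degenerate if the restriction of $\langle\cdot,\cdot\rangle$ to it is nondegenerate. The symmetric part of the Levi-Civita connection is the symmetric bilinear map $U:\mathfrak{g}\times\mathfrak{g}\to\mathfrak{g}$ determined by $$2\langle U(X,Y),Z\rangle=\langle[Z,X],Y\rangle+\langle[Z,Y],X\rangle\qquad\text{for all }X,Y,Z\in\mathfrak{g};$$ it defines an associative product if $U(U(X,Y),Z)=U(X,U(Y,Z))$ for all $X,Y,Z\in\mathfrak{g}$. Two pseudo-Riemannian Lie algebras are isometrically isomorphic if there is a Lie algebra isomorphism between them that preserves the scalar products. The direct product of pseudo-Riemannian Lie algebras is the direct product Lie algebra with the orthogonal sum of the two scalar products. For a finite-dimensional real vector space $W$ with dual $W^*$, $\mathbb{T}W:=W\oplus W^*$ carries the canonical neutral metric $\langle\!\langle X+\xi,Y+\eta\rangle\!\rangle=\eta(X)+\xi(Y)$ for $X,Y\in W$, $\xi,\eta\in W^*$. A linear map $\beta:W^*\to W$ with $\langle\!\langle\beta\eta,\xi\rangle\!\rangle=-\langle\!\langle\eta,\beta\xi\rangle\!\rangle$ for all $\xi,\eta\in W^*$ is identified with a bivector on $W$; it is non-degenerate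 if $\beta$ is a linear isomorphism. The associated infinitesimal $\beta$-transformation is the map $D_\beta\in\mathfrak{so}(\mathbb{T}W,\langle\!\langle\cdot,\cdot\rangle\!\rangle)$ given by $D_\beta(X+\xi)=\beta\xi$ for $X\in W$, $\xi\in W^*$. The Lie algebra $\mathbb{R}e\ltimes_{D_\beta}\mathbb{T}W$ is the vector space $\mathbb{R}e\oplus\mathbb{T}W$ in which $\mathbb{T}W$ is an abelian ideal and $[e,v]=D_\beta v$ for $v\in\mathbb{T}W$. *)

(* Defs.v *)
From HB Require Import structures.
From mathcomp Require Import all_boot all_order all_algebra.
From mathcomp Require Import reals.

Set Implicit Arguments.
Unset Strict Implicit.
Unset Printing Implicit Defensive.

Import Order.TTheory GRing.Theory Num.Theory.
Local Open Scope ring_scope.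

HB.mixin Record isLieAlgebra (R : fieldType) L of Vector R L := {
  lie : L -> L -> L;
  lie_linearl : forall y, linear (lie^~ y);
  lie_linearr : forall x, linear (lie x);
  lie_xx : forall x, lie x x = 0;
  lie_jacobi : forall x y z,
    lie x (lie y z) + lie y (lie z x) + lie z (lie x y) = 0
}.

#[short(type="lieAlgType")]
HB.structure Definition LieAlgebra (R : fieldType) :=
  {L of Vector R L & isLieAlgebra R L}.

Section LieAlgebraNotions.
Variables (R : fieldType) (g : lieAlgType R).

Definition abelian_lie_algebra : Prop := forall x y : g, lie x y = 0.

Definition abelian_ideal (a : {vspace g}) : Prop :=
  (forall x y, y \in a -> lie x y \in a) /\
  {in a & a, forall x y, lie x y = 0}.

Definition codim_one (a : {vspace g}) : Prop := \dim {:g} = (\dim a).+1.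

Definition almost_abelian : Prop :=
  ~ abelian_lie_algebra /\
  exists a : {vspace g}, abelian_ideal a /\ codim_one a.

End LieAlgebraNotions.

Definition abelian_lie (R : fieldType) (V : vectType R) : Type := V.

Section AbelianLie.
Variables (R : fieldType) (V : vectType R).

HB.instance Definition _ := Vector.on (abelian_lie V).

Let br (_ _ : abelian_lie V) : abelian_lie V := 0.

Fact abelian_lie_linearl y : linear (br^~ y).
Proof. by move=> c u v; rewrite /br scaler0 addr0. Qed.

Fact abelian_lie_linearr x : linear (br x).
Proof. by move=> c u v; rewrite /br scaler0 addr0. Qed.

Fact abelian_lie_xx x : br x x = 0. Proof. by []. Qed.

Fact abelian_lie_jacobi x y z :
  br x (br y z) + br y (br z x) + br z (br x y) = 0.
Proof. by rewrite /br !addr0. Qed.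

HB.instance Definition _ := isLieAlgebra.Build R (abelian_lie V)
  abelian_lie_linearl abelian_lie_linearr abelian_lie_xx abelian_lie_jacobi.

End AbelianLie.

Section ProductLie.
Variables (R : fieldType) (g h : lieAlgType R).

Let br (x y : g * h) : g * h := (lie x.1 y.1, lie x.2 y.2).

Fact prod_lie_linearl y : linear (br^~ y).
Proof. by move=> c u v; rewrite /br /= !lie_linearl. Qed.

Fact prod_lie_linearr x : linear (br x).
Proof. by move=> c u v; rewrite /br /= !lie_linearr. Qed.

Fact prod_lie_xx x : br x x = 0.
Proof. by rewrite /br !lie_xx. Qed.

Fact prod_lie_jacobi x y z :
  br x (br y z) + br y (br z x) + br z (br x y) = 0.
Proof. by congr (_, _); apply: lie_jacobi. Qed.

HB.instance Definition _ := isLieAlgebra.Build R (g * h)%type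
  prod_lie_linearl prod_lie_linearr prod_lie_xx prod_lie_jacobi.

End ProductLie.

(* The Lie algebra R e |x_D V: the pair (s, v) stands for s e + v, so that e is
   (1, 0), V is an abelian ideal and [e, v] = D v. *)
Definition semidirect (R : fieldType) (V : vectType R) (D : 'End(V)) : Type :=
  (R^o * V)%type.

Section Semidirect.
Variables (R : fieldType) (V : vectType R) (D : 'End(V)).

HB.instance Definition _ := Vector.on (semidirect D).

Let br (x y : semidirect D) : semidirect D :=
  (0, x.1 *: D y.2 - y.1 *: D x.2).

Fact semidirect_lie_linearl y : linear (br^~ y).
Proof.
move=> c u v; rewrite /br; congr (_, _) => /=; first by rewrite scaler0 addr0.
rewrite linearP /= scalerDl scalerDr scalerBr -scalerA [y.1 *: (c *: _)]scalerA.
by rewrite mulrC -scalerA opprD addrACA.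
Qed.

Fact semidirect_lie_xx x : br x x = 0.
Proof. by rewrite /br subrr. Qed.

Let brC x y : br x y = - br y x.
Proof. by rewrite /br; congr (_, _); rewrite /= ?oppr0 ?opprB. Qed.

Fact semidirect_lie_linearr x : linear (br x).
Proof.
move=> c u v; rewrite brC semidirect_lie_linearl opprD -scalerN.
by rewrite -!(brC x).
Qed.

Fact semidirect_lie_jacobi x y z :
  br x (br y z) + br y (br z x) + br z (br x y) = 0.
Proof.
rewrite /br; congr (_, _) => /=; first by rewrite !addr0.
rewrite !scale0r !subr0 !linearB !linearZ /= !scalerA.
rewrite !scalerN.
set a := _ *: D (D z.2); set b := _ *: D (D y.2); set c := _ *: D (D x.2).
by rewrite (addrC c) [X in X + _]addrACA subrr add0r addrACA addNr subrr addr0.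
Qed.

HB.instance Definition _ := isLieAlgebra.Build R (semidirect D)
  semidirect_lie_linearl semidirect_lie_linearr
  semidirect_lie_xx semidirect_lie_jacobi.

End Semidirect.

HB.factory Record isSymmetricForm (R : fieldType) (V : lmodType R)
    (B : V -> V -> R) := {
  symform_sym : forall x y, B x y = B y x;
  symform_linear : forall y, scalar (B^~ y)
}.

HB.builders Context R V B of isSymmetricForm R V B.

Fact symform_bilinear : bilinear_for
  (GRing.Scale.Law.clone _ _ *%R _) (GRing.Scale.Law.clone _ _ *%R _) B.
Proof.
split=> u c x y; first exact: symform_linear.
by rewrite !(symform_sym u) symform_linear.
Qed.

HB.instance Definition _ := bilinear_isBilinear.Build R V V R _ _ B
  symform_bilinear.

Fact symform_hermitian x y : B x y = (-1) ^+ false * idfun (B y x).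
Proof. by rewrite mul1r symform_sym. Qed.

HB.instance Definition _ := isHermitianSesquilinear.Build R V false idfun B
  symform_hermitian.

HB.end.

Section RestrictedForm.
Variables (R : fieldType) (V : vectType R) (B : {symmetric V}).
Variable (a : {vspace V}).

Definition restrict_fun (x y : subvs_of a) : R := B (vsval x) (vsval y).

Fact restrict_fun_sym x y : restrict_fun x y = restrict_fun y x.
Proof. by rewrite /restrict_fun hermC mul1r. Qed.

Fact restrict_fun_linear y : scalar (restrict_fun^~ y).
Proof. by move=> c u v; rewrite /restrict_fun linearP linearPl. Qed.

HB.instance Definition _ := isSymmetricForm.Build R (subvs_of a) restrict_fun
  restrict_fun_sym restrict_fun_linear.

Definition restrict_form : {symmetric (subvs_of a)} := restrict_fun.

End RestrictedForm.

Arguments restrict_form {R V} B a.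

Section ProductForm.
Variables (R : fieldType) (V1 V2 : vectType R).
Variables (B1 : {symmetric V1}) (B2 : {symmetric V2}).

Definition prod_fun (x y : V1 * V2) : R := B1 x.1 y.1 + B2 x.2 y.2.

Fact prod_fun_sym x y : prod_fun x y = prod_fun y x.
Proof. by rewrite /prod_fun (hermC B1) (hermC B2) !mul1r. Qed.

Fact prod_fun_linear y : scalar (prod_fun^~ y).
Proof.
by move=> c u v; rewrite /prod_fun /= !linearPl mulrDr addrACA.
Qed.

HB.instance Definition _ := isSymmetricForm.Build R (V1 * V2)%type prod_fun
  prod_fun_sym prod_fun_linear.

Definition prod_form : {symmetric (V1 * V2)%type} := prod_fun.

End ProductForm.

(* p is the number of positive directions and q that of negative ones; the
   existence of b forces B to be nondegenerate. *)
Definition has_signature (R : realFieldType) (V : vectType R)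
    (B : {symmetric V}) (p q : nat) : Prop :=
  exists2 b : (p + q).-tuple V, basis_of {:V} b &
    forall i j : 'I_(p + q),
      B b`_i b`_j = if i != j then 0 else if (i < p)%N then 1 else -1.

Definition isometrically_isomorphic (R : fieldType) (g h : lieAlgType R)
    (B : {symmetric g}) (C : {symmetric h}) : Prop :=
  exists f : 'Hom(g, h),
    [/\ bijective f, {morph f : x y / lie x y} & isometry C B f].

Section SymmetricPart.
Variables (R : fieldType) (g : lieAlgType R) (B : {symmetric g}).

Definition LC_symmetric_part (U : g -> g -> g) : Prop :=
  forall X Y Z, 2 * B (U X Y) Z = B (lie Z X) Y + B (lie Z Y) X.

Lemma LC_symmetric_part_exists : 2 != 0 :> R -> nondegenerate B ->
  exists U, LC_symmetric_part U.
Proof.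
move=> two_neq0 ndB.
pose flat1 x : 'Hom(g, R^o) := linfun (B x : g -> R^o).
have flat1E x y : flat1 x y = B x y by rewrite lfunE.
have flat1_lin : linear flat1.
  by move=> c u v; apply/lfunP => w; rewrite add_lfunE scale_lfunE !flat1E linearPl.
pose flatL : {linear g -> 'Hom(g, R^o)} :=
  HB.pack flat1 (GRing.isLinear.Build _ _ _ _ flat1 flat1_lin).
pose flat := linfun flatL.
have flatE x y : flat x y = B x y by rewrite lfunE /= flat1E.
have ker0 : lker flat == 0%VS.
  apply/lker0P => x y eq_xy; apply/eqP; rewrite -subr_eq0 -memv0 -(eqP ndB).
  apply/mem_orthovP => z _; have Bxy : B x z = B y z by rewrite -!flatE eq_xy.
  by rewrite linearBl /= Bxy subrr.
have full : limg flat = fullv.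
  apply/eqP; rewrite eqEdim subvf limg_dim_eq ?(eqP ker0) ?capv0 //.
  by rewrite !dimvf /dim /= muln1.
pose r X Y Z : R^o := 2^-1 * (B (lie Z X) Y + B (lie Z Y) X).
have r_lin X Y : linear (r X Y).
  have rP (c s s' t t' : R) : 2^-1 * (c * s + s' + (c * t + t')) =
      c * (2^-1 * (s + t)) + 2^-1 * (s' + t').
    by rewrite [in LHS]addrACA -(mulrDr c) (mulrDr 2^-1) mulrCA.
  by move=> c u v; rewrite /r !lie_linearl !linearPl; apply: rP.
pose rL X Y : {linear g -> R^o} :=
  HB.pack (r X Y) (GRing.isLinear.Build _ _ _ _ (r X Y) (r_lin X Y)).
exists (fun X Y => (flat^-1)%VF (linfun (rL X Y))) => X Y Z.
by rewrite -flatE limg_lfunVK ?full ?memvf // lfunE /= /r mulVKf.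
Qed.

Lemma LC_symmetric_part_unique U U' : 2 != 0 :> R -> nondegenerate B ->
  LC_symmetric_part U -> LC_symmetric_part U' -> U =2 U'.
Proof.
move=> two_neq0 ndB hU hU' X Y.
apply/eqP; rewrite -subr_eq0 -memv0 -(eqP ndB); apply/mem_orthovP => Z _.
by rewrite linearBl; apply: (mulfI two_neq0); rewrite mulrBr hU hU' subrr mulr0.
Qed.

End SymmetricPart.

Section GeneralizedTangent.
Variables (R : fieldType) (W : vectType R).

Definition dual : vectType R := 'Hom(W, R^o).

Definition TT : vectType R := (W * dual)%type.

Definition neutral_form (x y : TT) : R := y.2 x.1 + x.2 y.1.

Fact neutral_form_sym x y : neutral_form x y = neutral_form y x.
Proof. by rewrite /neutral_form addrC. Qed.

Fact neutral_form_linear y : scalar (neutral_form^~ y).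
Proof.
move=> c u v; rewrite /neutral_form /= linearP add_lfunE scale_lfunE.
by rewrite mulrDr addrACA.
Qed.

HB.instance Definition _ := isSymmetricForm.Build R TT neutral_form
  neutral_form_sym neutral_form_linear.

Variable beta : 'Hom(dual, W).

Definition bivector : Prop := forall xi eta : dual,
  neutral_form (beta eta, 0) (0, xi) = - neutral_form (0, eta) (beta xi, 0).

Definition nondegenerate_bivector : Prop := bivector /\ bijective beta.

Definition beta_fun (v : TT) : TT := (beta v.2, 0).

Fact beta_fun_linear : linear beta_fun.
Proof.
move=> c u v; rewrite /beta_fun; congr (_, _) => /=; first by rewrite linearP.
by rewrite scaler0 addr0.
Qed.

HB.instance Definition _ := GRing.isLinear.Build R TT TT _ beta_fun
  beta_fun_linear.

Definition beta_transform : 'End(TT) := linfun beta_fun.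

Lemma beta_transformE v : beta_transform v = (beta v.2, 0).
Proof. by rewrite lfunE. Qed.

Lemma beta_transform_skew : bivector -> forall u v,
  neutral_form (beta_transform u) v = - neutral_form u (beta_transform v).
Proof.
move=> skew u v; rewrite !beta_transformE /neutral_form /= !lfunE /= !(addr0, add0r).
by have := skew v.2 u.2; rewrite /neutral_form /= !lfunE /= !(addr0, add0r).
Qed.

End GeneralizedTangent.

(* The metrics on R e |x_{D_beta} TW with <e, e> = 1 or -1, with e orthogonal to
   TW, and restricting to the neutral metric on TW. *)
Definition extends_neutral (R : fieldType) (W : vectType R)
    (beta : 'Hom(dual W, W))
    (B1 : {symmetric semidirect (beta_transform beta)}) : Prop :=
  let e : semidirect (beta_transform beta) := (1, 0) in
  let i (v : TT W) : semidirect (beta_transform beta) := (0, v) in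
  [/\ nondegenerate B1, B1 e e = 1 \/ B1 e e = -1,
      forall v, B1 e (i v) = 0
    & forall u v, B1 (i u) (i v) = neutral_form u v].

(* Main.v *)
Require Import Defs.
From HB Require Import structures.
From mathcomp Require Import all_boot all_order all_algebra.
From mathcomp Require Import reals.
From mathcomp Require Import ring zify.

Set Implicit Arguments.
Unset Strict Implicit.
Unset Printing Implicit Defensive.

Import Order.TTheory GRing.Theory Num.Theory.
Local Open Scope ring_scope.

(* Write D = ad_e and x_e for the e-coordinate of x. Since a is an abelian ideal
   and D is skew, [x, y] = x_e D y - y_e D x and 2 U(x, y) = x_e D y + y_e D x;
   as D takes values in a, associativity of U amounts to D^2 = 0.
   If D^2 = 0, the image W of D is totally isotropic, so the inclusion of W in a
   extends to an isometric embedding phi of TW, and beta xi = D (phi xi) is a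
   non-degenerate bivector: if D (phi xi) = 0 then phi xi is orthogonal to W, that
   is, xi = 0. Being skew, beta forces dim W to be even. The orthogonal complement of
   R e + phi (TW) is orthogonal to im D, hence killed by D, and gives the abelian
   factor. Conversely the product algebra is 2-step nilpotent, so D^2 = 0. *)

(** * Linear maps between finite-dimensional spaces *)

Lemma linear_lfun (F : fieldType) (V W : vectType F) (f : V -> W) :
  linear f -> exists g : 'Hom(V, W), g =1 f.
Proof.
move=> f_lin; pose fL : {linear V -> W} :=
  HB.pack f (GRing.isLinear.Build _ _ _ _ f f_lin).
by exists (linfun fL) => x; rewrite lfunE.
Qed.

Lemma lker0_trivial (F : fieldType) (V W : vectType F) (f : 'Hom(V, W)) :
  (forall x, f x = 0 -> x = 0) -> lker f == 0%VS.
Proof.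
move=> f0; apply/lker0P => x y fxy; apply/eqP; rewrite -subr_eq0; apply/eqP/f0.
by rewrite linearB /= fxy subrr.
Qed.

Lemma lker0_bij (F : fieldType) (V W : vectType F) (f : 'Hom(V, W)) :
  lker f == 0%VS -> \dim {:V} = \dim {:W} -> bijective f.
Proof.
move=> ker0 dimVW; exists (f^-1)%VF => [|y]; first exact: lker0_lfunK.
apply: limg_lfunVK; suff -> : limg f = fullv by rewrite memvf.
by apply/eqP; rewrite eqEdim subvf limg_dim_eq ?(eqP ker0) ?capv0 //= dimVW.
Qed.

(** * Symmetric forms, neutral spaces, bivectors and orthogonal complements *)

Section SymmetricForm.
Variables (F : fieldType) (V : vectType F) (B : {symmetric V}).

Lemma symformC x y : B x y = B y x.
Proof. by rewrite hermC mul1r. Qed.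

Lemma symform0l y : B 0 y = 0.
Proof. exact: linear0l. Qed.

Lemma symform0r x : B x 0 = 0.
Proof. exact: linear0r. Qed.

Lemma symformDl x y z : B (x + y) z = B x z + B y z.
Proof. exact: linearDl. Qed.

Lemma symformDr x y z : B x (y + z) = B x y + B x z.
Proof. exact: linearDr. Qed.

Lemma symformBl x y z : B (x - y) z = B x z - B y z.
Proof. exact: linearBl. Qed.

Lemma symformBr x y z : B x (y - z) = B x y - B x z.
Proof. exact: linearBr. Qed.

Lemma symform_suml I (r : seq I) (P : pred I) (E : I -> V) y :
  B (\sum_(i <- r | P i) E i) y = \sum_(i <- r | P i) B (E i) y.
Proof. exact: linear_sumlz. Qed.

Lemma symform_sumr I (r : seq I) (P : pred I) (E : I -> V) x :
  B x (\sum_(i <- r | P i) E i) = \sum_(i <- r | P i) B x (E i).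
Proof. exact: linear_sumr. Qed.

Lemma symformZl c x y : B (c *: x) y = c * B x y.
Proof. by rewrite linearZl_LR. Qed.

Lemma symformZr c x y : B x (c *: y) = c * B x y.
Proof. by rewrite linearZr_LR. Qed.

Lemma nondegenerate0 x : nondegenerate B -> (forall y, B x y = 0) -> x = 0.
Proof.
move=> /eqP ndB Bx0; apply/eqP; rewrite -memv0 -ndB.
by apply/mem_orthovP => y _; apply: Bx0.
Qed.

Lemma nondegenerateP : (forall x, (forall y, B x y = 0) -> x = 0) -> nondegenerate B.
Proof.
move=> B0; apply/eqP/vspaceP => x; rewrite memv0; apply/idP/eqP => [/mem_orthovP Bx|->].
  by apply: B0 => y; apply: Bx; rewrite memvf.
exact: mem0v.
Qed.

Lemma nondegenerate_ext x y : nondegenerate B -> (forall z, B x z = B y z) -> x = y.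
Proof.
move=> ndB Bxy; apply/eqP; rewrite -subr_eq0; apply/eqP/nondegenerate0 => // z.
by rewrite linearBl /= Bxy subrr.
Qed.

(** The map [G] sends [x] to the vector whose coordinates are the values of [B x] on a basis.
    Nondegeneracy makes this endomorphism injective, hence invertible, and the representing vector
    is the preimage of the vector formed from the values of [L]. *)
Lemma symform_represents (L : V -> F) :
  nondegenerate B -> scalar L -> exists x, forall y, B x y = L y.
Proof.
move=> ndB L_lin.
have [G GE] : exists G : 'End(V),
    G =1 fun x => \sum_(i < \dim {:V}) B x (vbasis {:V})`_i *: (vbasis {:V})`_i.
  apply: linear_lfun => c u v; rewrite scaler_sumr -big_split; apply: eq_bigr => i _ /=.
  by rewrite linearPl scalerDl scalerA.
have LE y : L y = \sum_(i < \dim {:V}) coord (vbasis {:V}) i y * L (vbasis {:V})`_i.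
  have [M ME] := @linear_lfun _ V F^o L L_lin.
  rewrite -!ME {1}(coord_vbasis (memvf y)) linear_sum; apply: eq_bigr => i _.
  by rewrite linearZ -ME.
have freeb : free (vbasis {:V}) := basis_free (vbasisP _).
have form_coord x y :
    B x y = \sum_(i < \dim {:V}) coord (vbasis {:V}) i y * B x (vbasis {:V})`_i.
  rewrite {1}(coord_vbasis (memvf y)) linear_sum; apply: eq_bigr => i _.
  by rewrite linearZ.
have G0 : lker G == 0%VS.
  apply: lker0_trivial => x; rewrite GE => Gx0; apply: nondegenerate0 => // y.
  rewrite form_coord big1 // => i _.
  have := congr1 (coord (vbasis {:V}) i) Gx0.
  by rewrite coord_sum_free // linear0 => ->; rewrite mulr0.
pose x := (G^-1)%VF (\sum_(i < \dim {:V}) L (vbasis {:V})`_i *: (vbasis {:V})`_i).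
exists x => y; rewrite LE form_coord; apply: eq_bigr => i _; congr (_ * _).
have := lker0_lfunVK G0 (\sum_(i < \dim {:V}) L (vbasis {:V})`_i *: (vbasis {:V})`_i).
by rewrite GE -/x => /(congr1 (coord (vbasis {:V}) i)); rewrite !coord_sum_free.
Qed.

End SymmetricForm.

Lemma isometry_injective (F : fieldType) (N V : vectType F)
    (B : {symmetric V}) (C : {symmetric N}) (h : 'Hom(N, V)) :
  nondegenerate C -> isometry B C h -> lker h == 0%VS.
Proof.
move=> ndC iso_h; apply: lker0_trivial => x hx0.
by apply: (nondegenerate0 ndC) => y; rewrite -iso_h hx0 linear0l.
Qed.

(** Nondegeneracy supplies vectors [u i] dual to a basis of [W0]. Once corrected so as to span an
    isotropic space, they receive the dual part: a covector goes to their combination weighted by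
    its values on that basis. *)
Lemma isotropic_embedding (F : fieldType) (V : vectType F) (B : {symmetric V})
    (W0 : {vspace V}) :
  2 != 0 :> F -> nondegenerate B -> {in W0 &, forall x y, B x y = 0} ->
  exists phi : 'Hom(TT (subvs_of W0), V),
    isometry B (@neutral_form F (subvs_of W0)) phi /\
    forall w, phi (w, 0) = vsval w.
Proof.
move=> two_neq0 ndB isoW; pose W := subvs_of W0.
pose b := vbasis {:W}.
have [u uE] : exists u : 'I_(\dim {:W}) -> V,
    forall i x, B (u i) x = coord b i (vsproj W0 x).
  suff /fin_all_exists[u uE] : forall i : 'I_(\dim {:W}),
    exists u, forall x, B u x = coord b i (vsproj W0 x) by exists u.
  (* The projection [vsproj W0] extends the i-th coordinate functional from [W0] to all of [V]. *)
  by move=> i; apply: symform_represents => // c x y; rewrite !linearP.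
pose w i : V := vsval b`_i.
(* Subtracting half the Gram matrix makes the span of the u' i isotropic. *)
pose u' i := u i - 2^-1 *: \sum_j B (u i) (u j) *: w j.
have isoW' (x y : W) : B (vsval x) (vsval y) = 0 by rewrite isoW ?subvsP.
have wu i x : B (u i) (vsval x) = coord b i x by rewrite uE vsvalK.
have u'w i x : B (u' i) (vsval x) = coord b i x.
  rewrite /u' symformBl symformZl symform_suml big1 ?mulr0 ?subr0 ?wu // => j _.
  by rewrite symformZl isoW' mulr0.
have wj (i j : 'I_(\dim {:W})) : coord b i b`_j = (i == j)%:R.
  by rewrite coord_free ?(basis_free (vbasisP _)) // eq_sym.
(* Each of the two mixed terms removes half of [B (u i) (u j)], and the terms pairing [w] with [w]
   vanish by isotropy. *)
have u'u' i j : B (u' i) (u' j) = 0.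
  rewrite {2}/u' symformBr symformZr symform_sumr.
  under eq_bigr => l _ do rewrite symformZr u'w wj.
  rewrite (bigD1 i) //= eqxx mulr1 big1 ?addr0 => [|l li]; last first.
    by rewrite eq_sym (negPf li) mulr0.
  rewrite /u' symformBl symformZl symform_suml.
  under eq_bigr => l _ do rewrite symformZl [B (w l) _]symformC wu wj.
  rewrite (bigD1 j) //= eqxx mulr1 big1 ?addr0 => [|l lj]; last first.
    by rewrite eq_sym (negPf lj) mulr0.
  rewrite (symformC _ (u j)) -addrA -opprD -mulrDl -mulr2n.
  by rewrite -(mulr_natl 2^-1) mulfV // mul1r subrr.
have [phi phiE] : exists phi : 'Hom(TT W, V),
    phi =1 fun v => vsval v.1 + \sum_(i < \dim {:W}) v.2 b`_i *: u' i.
  apply: linear_lfun => c x y /=; rewrite scalerDr addrACA; congr (_ + _).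
  rewrite scaler_sumr -big_split; apply: eq_bigr => i _ /=.
  by rewrite add_lfunE scale_lfunE scalerDl scalerA.
have dualE (xi : dual W) x : \sum_(i < \dim {:W}) xi b`_i * coord b i x = xi x.
  rewrite [in RHS](coord_vbasis (memvf x)) linear_sum; apply: eq_bigr => i _.
  by rewrite linearZ mulrC.
exists phi; split=> [x y|x]; last first.
  by rewrite phiE /= big1 ?addr0 // => i _; rewrite lfunE scale0r.
rewrite !phiE symformDl !symformDr isoW' add0r /neutral_form; congr (_ + _).
  rewrite symform_sumr -dualE; apply: eq_bigr => i _ /=.
  by rewrite symformZr symformC u'w.
rewrite symform_suml -[RHS]addr0 -dualE; congr (_ + _).
  by apply: eq_bigr => i _; rewrite symformZl u'w.
rewrite symform_suml big1 // => i _; rewrite symform_sumr big1 // => j _.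
by rewrite symformZl symformZr u'u' !mulr0.
Qed.

(** In the basis [xi] dual to [b], the matrix [M] of [beta] is skew, and injectivity of [beta] makes
    it invertible; a determinant argument then excludes odd size. *)
Lemma nondegenerate_bivector_even (R : numFieldType) (W : vectType R)
    (beta : 'Hom(dual W, W)) :
  nondegenerate_bivector beta -> ~~ odd (\dim {:W}).
Proof.
move=> [skew bij_b]; set r := \dim {:W}; pose b := vbasis {:W}.
have [xi xiE] : exists xi : 'I_r -> dual W, forall i, xi i =1 coord b i.
  suff /fin_all_exists : forall i : 'I_r, exists f : dual W, f =1 coord b i by [].
  by move=> i; apply: linear_lfun => c x y; rewrite linearP.
have skewE (s t : dual W) : t (beta s) = - s (beta t).
  by have := skew t s; rewrite /neutral_form /= !lfunE /= !(addr0, add0r).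
pose M := \matrix_(i < r, j < r) (xi j (beta (xi i)) : R).
have MT : M^T = -1 *: M by apply/matrixP => i j; rewrite !mxE skewE mulN1r.
have : \det M != 0.
  (* The entries of [v *m M] are the coordinates of the image under [beta] of the combination of the
     [xi i] with weights [v]. *)
  apply/det0P => -[v /negP v0 vM]; apply: v0; apply/eqP/rowP => j; rewrite mxE.
  have bs0 : beta (\sum_i v 0 i *: xi i) = 0.
    rewrite [LHS](coord_vbasis (memvf _)) big1 // => l _.
    rewrite -xiE linear_sum linear_sum; have := congr1 (fun A : 'rV__ => A 0 l) vM.
    rewrite !mxE; under eq_bigr => i _ do rewrite mxE.
    under [in X in _ -> X *: _ = _]eq_bigr => i _ do rewrite !linearZ /=.
    by move=> ->; rewrite scale0r.
  have s0 : \sum_i v 0 i *: xi i = 0 by apply: (bij_inj bij_b); rewrite bs0 linear0.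
  have := congr1 (fun f : dual W => f b`_j) s0; rewrite sum_lfunE lfunE /=.
  rewrite (bigD1 j) //= big1 ?addr0 => [|i ij].
    rewrite scale_lfunE xiE coord_free ?(basis_free (vbasisP _)) // eqxx.
    by rewrite /GRing.scale /= mulr1.
  rewrite scale_lfunE xiE coord_free ?(basis_free (vbasisP _)) // eq_sym (negPf ij).
  by rewrite scaler0.
(* In odd dimension a skew matrix satisfies det M = - det M. *)
apply: contraNN => odd_r; have := det_tr M.
rewrite MT detZ -signr_odd odd_r mulN1r => /esym/eqP.
by rewrite -addr_eq0 -mulr2n mulrn_eq0.
Qed.

Lemma bij_dim (F : fieldType) (V W : vectType F) (f : 'Hom(V, W)) :
  bijective f -> \dim {:V} = \dim {:W}.
Proof.
move=> bij_f; have ker0 : lker f == 0%VS by apply/lker0P; apply: bij_inj.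
have <- : limg f = fullv.
  apply/vspaceP => y; rewrite memvf; apply/memv_imgP.
  by case: bij_f => f' _ f'K; exists (f' y); rewrite ?memvf ?f'K.
by rewrite limg_dim_eq // (eqP ker0) capv0.
Qed.

Lemma dim_pair (F : fieldType) (V W : vectType F) :
  \dim {: (V * W)%type} = (\dim {:V} + \dim {:W})%N.
Proof. by rewrite !dimvf. Qed.

Lemma dim_dual (F : fieldType) (W : vectType F) : \dim {:dual W} = \dim {:W}.
Proof. by rewrite !dimvf /dim /= muln1. Qed.

(** The complement is parametrized by a prescribed space [M] of the right dimension, since the
    abelian factor of the theorem is a fixed coordinate space. The sum with the image of [h] is
    direct because [C] is nondegenerate, and dimensions give surjectivity. *)
Lemma orthogonal_complement (F : fieldType) (N M V : vectType F)
    (C : {symmetric N}) (B : {symmetric V}) (h : 'Hom(N, V)) :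
  nondegenerate C -> isometry B C h ->
  (\dim {:N} + \dim {:M})%N = \dim {:V} ->
  exists psi : 'Hom(M, V), (forall x t, B (h x) (psi t) = 0) /\
    bijective (fun z : N * M => h z.1 + psi z.2).
Proof.
move=> ndC iso_h dimNM; pose b := vbasis {:N}; pose c := vbasis {:M}.
have [G GE] : exists G : 'Hom(V, 'rV[F]_(\dim {:N})),
    G =1 fun x => \row_(j < \dim {:N}) B (h b`_j) x.
  by apply: linear_lfun => s x y; apply/rowP => j; rewrite !mxE linearP.
pose E := lker G; have EP x y : x \in E -> B (h y) x = 0.
  rewrite memv_ker => /eqP Gx0; rewrite (coord_vbasis (memvf y)) linear_sum symform_suml.
  rewrite big1 // => j _; rewrite linearZ /= symformZl.
  by have := congr1 (fun A : 'rV__ => A 0 j) Gx0; rewrite GE !mxE => ->; rewrite mulr0.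
(* Rank-nullity for [G] gives this inequality, which is enough to embed [M] in [E]. *)
have dimE : (\dim {:M} <= \dim E)%N.
  have := limg_ker_dim G fullv; rewrite capfv -/E -dimNM => dimEG.
  have : (\dim (G @: fullv) <= \dim {:N})%N.
    by apply: leq_trans (dimvS (subvf _)) _; rewrite dimvf /dim /= mul1n.
  by lia.
(* The basis of [M] goes to the first [\dim {:M}] vectors of a basis of [E]. *)
have [psi psiE] : exists psi : 'Hom(M, V),
    psi =1 fun t => \sum_(i < \dim {:M}) coord c i t *: (vbasis E)`_i.
  apply: linear_lfun => s x y; rewrite scaler_sumr -big_split; apply: eq_bigr => i _ /=.
  by rewrite linearP scalerDl scalerA.
have psi_in t : psi t \in E.
  rewrite psiE rpred_sum // => i _; rewrite rpredZ // vbasis_mem // mem_nth //.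
  by rewrite size_tuple (leq_trans _ dimE).
have psi0 t : psi t = 0 -> t = 0.
  rewrite psiE => t0; rewrite (coord_vbasis (memvf t)) big1 // => i _.
  have := congr1 (coord (vbasis E) (widen_ord dimE i)) t0.
  rewrite linear0 linear_sum (bigD1 i) //= big1 ?addr0 => [|j ji]; last first.
    rewrite linearZ /= (coord_free (widen_ord dimE j) (widen_ord dimE i))
      ?(basis_free (vbasisP _)) //.
    by rewrite -val_eqE /= val_eqE (negPf ji) mulr0.
  rewrite linearZ /= (coord_free (widen_ord dimE i) (widen_ord dimE i))
    ?(basis_free (vbasisP _)) //.
  by rewrite eqxx mulr1 => ->; rewrite scale0r.
exists psi; split=> [x t|]; first exact: EP.
have [H HE] : exists H : 'Hom((N * M)%type, V), H =1 fun z => h z.1 + psi z.2.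
  by apply: linear_lfun => s x y; rewrite !linearP scalerDr addrACA.
apply: (eq_bij _ HE); apply: lker0_bij; last by rewrite dim_pair.
apply: lker0_trivial => -[x t]; rewrite HE /= => /eqP; rewrite addr_eq0 => /eqP hx.
(* Here [h x] is the opposite of [psi t], hence orthogonal to the image of [h], so [x] lies in the
   radical of [C]. *)
have x0 : x = 0.
  apply: (nondegenerate0 ndC) => y;
    rewrite symformC -iso_h hx -scaleN1r symformZr EP ?mulr0 //.
congr (_, _) => //; apply: psi0; apply/eqP; rewrite -oppr_eq0 -hx x0 linear0 //.
Qed.

(** * Signatures and orthonormal bases *)

Section Signature.
Variables (R : realFieldType) (V : vectType R) (B : {symmetric V}).

(** Pairing a vanishing combination with one member isolates its coefficient up to sign, so the
    family is free. Indices are plain naturals, which suits lists built by [map], [cons] and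
    [rcons]. *)
Lemma orthonormal_signature (s : seq V) (p q : nat) :
  size s = (p + q)%N -> \dim {:V} = (p + q)%N ->
  (forall i j : nat, (i < p + q)%N -> (j < p + q)%N ->
    B s`_i s`_j = if i != j then 0 else if (i < p)%N then 1 else -1) ->
  has_signature B p q.
Proof.
move=> /eqP sz dimV gram; exists (Tuple sz) => [|i j] /=; last by rewrite gram.
rewrite basisEfree subvf /= (eqP sz) dimV leqnn !andbT.
apply/(@freeP _ _ _ (Tuple sz)) => c c0 i.
have : B (\sum_(j < p + q) c j *: s`_j) s`_i = 0 by rewrite c0 symform0l.
rewrite symform_suml (bigD1 i) //= big1 ?addr0 => [|j ji]; last first.
  by rewrite symformZl gram // ji mulr0.
rewrite symformZl gram // eqxx /= => /eqP.
by rewrite mulf_eq0; case: ltnP => _; rewrite ?oppr_eq0 oner_eq0 orbF => /eqP.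
Qed.

(** An isotropic vector whose positive coordinates all vanish is zero, because the form is then
    minus a sum of squares. Hence [W] embeds in the space of the [p] positive coordinates and,
    symmetrically, in that of the [q] negative ones. *)
Lemma isotropic_dim (p q : nat) (W : {vspace V}) :
  has_signature B p q -> {in W &, forall x y, B x y = 0} ->
  (\dim W <= minn p q)%N.
Proof.
move=> [b basis_b gram] isoW.
pose eps (i : 'I_(p + q)) : R := if (i < p)%N then 1 else -1.
have formE x : B x x = \sum_i eps i * coord b i x ^+ 2.
  rewrite {1 2}(coord_basis basis_b (memvf x)) symform_suml; apply: eq_bigr => i _.
  rewrite symformZl symform_sumr (bigD1 i) //= big1 ?addr0 => [|j ji].
    by rewrite symformZr gram eqxx /= -/(eps i) expr2; ring.
  by rewrite symformZr gram eq_sym ji mulr0.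
(* B is sg times a sum of squares where the coordinates indexed by s vanish. *)
have bound r (s : 'I_r -> 'I_(p + q)) (sg : R) : sg != 0 ->
    (forall i, (exists j, i = s j) \/ eps i = sg) -> (\dim W <= r)%N.
  move=> sg0 sgP; have [G GE] : exists G : 'Hom(V, 'rV[R]_r),
      G =1 fun x => \row_(j < r) coord b (s j) x.
    by apply: linear_lfun => c x y; apply/rowP => j; rewrite !mxE linearP.
  rewrite -(@limg_dim_eq _ _ _ G).
    by apply: leq_trans (dimvS (subvf _)) _; rewrite dimvf /dim /= mul1n.
  apply/vspaceP => x; rewrite memv_cap memv_ker memv0; apply/andP/eqP => [|->].
    move=> [xW /eqP Gx0]; have c0 j : coord b (s j) x = 0.
      by have := congr1 (fun A : 'rV__ => A 0 j) Gx0; rewrite GE !mxE.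
    have : \sum_i coord b i x ^+ 2 = 0.
      apply: (mulfI sg0); rewrite mulr0 mulr_sumr; apply: etrans (isoW _ _ xW xW);
        rewrite formE.
      apply: eq_bigr => i _; case: (sgP i) => [[j ->]|-> //].
      by rewrite c0 expr0n !mulr0.
    move/eqP; rewrite psumr_eq0 => [/allP sq0|i _]; last exact: sqr_ge0.
    rewrite (coord_basis basis_b (memvf x)) big1 // => i _.
    have := sq0 i; rewrite mem_index_enum => /(_ isT) /=.
    by rewrite expf_eq0 /= => /eqP ->; rewrite scale0r.
  by rewrite mem0v linear0.
rewrite leq_min; apply/andP; split.
  apply: (bound p (lshift q) (-1)); first by rewrite oppr_eq0 oner_eq0.
  move=> i; case: (splitP i) => j ij; [left; exists j; exact: val_inj|right].
  by rewrite /eps ij ltnNge leq_addr.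
apply: (bound q (@rshift p q) 1); first by rewrite oner_eq0.
move=> i; case: (splitP i) => j ij; [right|left; exists j; exact: val_inj].
by rewrite /eps ij ltn_ord.
Qed.

(** The vector [e] is adjoined to an orthonormal basis of [a]: in front when its norm is 1, at the
    end when it is -1, since positive directions are listed first. *)
Lemma has_signature_codim_one (a : {vspace V}) (e : V) (p q : nat) :
  has_signature (restrict_form B a) p q -> \dim {:V} = (\dim a).+1 ->
  e \in orthov B a -> B e e = 1 \/ B e e = -1 ->
  exists s t, has_signature B s t.
Proof.
move=> [b basis_b gram] codim /mem_orthovP e_a Bee.
have szb : size (map vsval b) = (p + q)%N by rewrite size_map size_tuple.
have dimV : \dim {:V} = (p + q).+1.
  by have := size_basis basis_b; rewrite codim dimvf => <-.
have Bb i j : (i < p + q)%N -> (j < p + q)%N -> B (map vsval b)`_i (map vsval b)`_j =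
    if i != j then 0 else if (i < p)%N then 1 else -1.
  move=> ip jp; rewrite !(nth_map 0) ?size_tuple //.
  exact: (gram (Ordinal ip) (Ordinal jp)).
have eb i : (i < p + q)%N -> B e (map vsval b)`_i = 0.
  by move=> ip; rewrite (nth_map 0) ?size_tuple // e_a ?subvsP.
case: Bee => Bee.
  exists p.+1, q; apply: (@orthonormal_signature (e :: map vsval b)); rewrite //= ?szb //.
  by move=> [|i] [|j] //= ip jp; rewrite ?eb ?Bb // symformC eb.
exists p, q.+1; apply: (@orthonormal_signature (rcons (map vsval b) e)).
- by rewrite size_rcons szb addnS.
- by rewrite dimV addnS.
move=> i j; rewrite addnS !ltnS !nth_rcons szb.
case: (ltngtP i (p + q)%N) => // ip _; case: (ltngtP j (p + q)%N) => // jp _.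
- exact: Bb.
- by rewrite symformC eb // jp neq_ltn ip.
- by rewrite eb // ip neq_ltn jp orbT.
by rewrite Bee ip jp eqxx /= ltnNge leq_addr.
Qed.

End Signature.

Lemma has_signature_isometry (R : realFieldType) (V W : vectType R)
    (B : {symmetric V}) (C : {symmetric W})
    (f : 'Hom(V, W)) (p q : nat) :
  bijective f -> isometry C B f -> has_signature B p q -> has_signature C p q.
Proof.
move=> bij_f iso_f [b basis_b gram].
have sz : size (map f b) = (p + q)%N by rewrite size_map size_tuple.
apply: (orthonormal_signature sz).
  by rewrite -(bij_dim bij_f) (size_basis basis_b).
move=> i j ip jp; rewrite !(nth_map 0) ?size_tuple // iso_f.
exact: (gram (Ordinal ip) (Ordinal jp)).
Qed.

(** * Pulled back forms and the neutral form *)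

Section PullbackForm.
Variables (F : fieldType) (V W : vectType F) (B : {symmetric W}) (h : 'Hom(V, W)).

(** Both factors of the normal form get their metric by pullback from [g], so that their embeddings
    are isometric by definition. *)
Definition pullback_fun (x y : V) : F := B (h x) (h y).

Fact pullback_fun_sym x y : pullback_fun x y = pullback_fun y x.
Proof. exact: symformC. Qed.

Fact pullback_fun_linear y : scalar (pullback_fun^~ y).
Proof. by move=> c u v; rewrite /pullback_fun linearP linearPl. Qed.

HB.instance Definition _ := isSymmetricForm.Build F V pullback_fun
  pullback_fun_sym pullback_fun_linear.

Definition pullback_form : {symmetric V} := pullback_fun.

End PullbackForm.

Lemma neutral_form_nondegenerate (F : fieldType) (W : vectType F) :
  nondegenerate (@neutral_form F W : {symmetric (TT W)}).
Proof.
apply: nondegenerateP => -[w xi] v0; congr (_, _).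
  rewrite (coord_vbasis (memvf w)) big1 // => i _.
  have [f fE] : exists f : dual W, f =1 coord (vbasis {:W}) i.
    by apply: linear_lfun => c x y; rewrite linearP.
  have : f w + xi 0 = 0 := v0 (0, f).
  by rewrite linear0 addr0 fE => ->; rewrite scale0r.
apply/lfunP => x; have : (0 : dual W) w + xi x = 0 := v0 (x, 0).
by rewrite !lfunE /= add0r.
Qed.

(** * Bilinearity and antisymmetry of the bracket *)

Section LieBracket.
Variables (F : fieldType) (g : lieAlgType F).
Implicit Types x y z : g.

Lemma lieDl x y z : lie (x + y) z = lie x z + lie y z.
Proof. by have := lie_linearl z 1 x y; rewrite /= !scale1r. Qed.

Lemma lieDr x y z : lie z (x + y) = lie z x + lie z y.
Proof. by have := lie_linearr z 1 x y; rewrite !scale1r. Qed.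

Lemma lie0l x : lie 0 x = 0.
Proof. by apply: (addIr (lie 0 x)); rewrite -lieDl !add0r. Qed.

Lemma lie0r x : lie x 0 = 0.
Proof. by apply: (addIr (lie x 0)); rewrite -lieDr !add0r. Qed.

Lemma lieZl c x y : lie (c *: x) y = c *: lie x y.
Proof. by have := lie_linearl y c x 0; rewrite /= lie0l !addr0. Qed.

Lemma lieZr c x y : lie x (c *: y) = c *: lie x y.
Proof. by have := lie_linearr x c y 0; rewrite lie0r !addr0. Qed.

Lemma lieC x y : lie x y = - lie y x.
Proof.
apply/eqP; rewrite -addr_eq0; have := lie_xx (x + y).
by rewrite lieDl !lieDr !lie_xx add0r addr0 => ->.
Qed.

End LieBracket.

(** * Associativity of [U] and the square of [ad_e] *)

Section AlmostAbelian.
Variables (R : numFieldType) (g : lieAlgType R) (B : {symmetric g}).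
Variables (a : {vspace g}) (e : g).
Hypotheses (ndB : nondegenerate B) (a_ideal : abelian_ideal a).
Hypotheses (a_codim : codim_one a) (e_gen : <[e]>%VS = orthov B a).
Hypothesis e_unit : B e e = 1 \/ B e e = -1.
Hypothesis ad_e_skew : forall x y, B (lie e x) y = - B x (lie e y).

Let eps := B e e.

(** Since [eps] is its own inverse, [eps * B e x] is the e-coordinate of [x] for either sign of
    [B e e]. *)
Lemma unit_normK : eps * eps = 1.
Proof. by rewrite /eps; case: e_unit => ->; rewrite ?mulrNN mulr1. Qed.

(** This is double orthogonality: [a] is contained in the orthogonal of [e], and both have
    codimension one because [e], having nonzero norm, is outside the radical. *)
Lemma mem_hyperplane x : (x \in a) = (B e x == 0).
Proof.
have -> : a = orthov B <[e]>.
  have e_orth : e \in orthov B a by rewrite -e_gen memv_line.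
  apply/eqP; rewrite eqEdim; apply/andP; split.
    by rewrite orthov_sym -memvE.
  have e_nrad : e \notin orthov B fullv.
    apply: contraTN isT => /mem_orthovP/(_ e (memvf e)) Bee0.
    by have := unit_normK; rewrite /eps Bee0 mulr0 => /esym/eqP; rewrite oner_eq0.
  have := eq_dim_orthov1 e_nrad; rewrite capfv => <-.
  by rewrite a_codim.
by rewrite mem_orthov1 symformC.
Qed.

Lemma sub_proj_in x : x - (eps * B e x) *: e \in a.
Proof.
rewrite mem_hyperplane symformBr symformZr -/eps mulrAC unit_normK mul1r.
by rewrite subrr.
Qed.

Lemma lie_hyperplane x y :
  lie x y = (eps * B e x) *: lie e y - (eps * B e y) *: lie e x.
Proof.
have split_e z : z = (eps * B e z) *: e + (z - (eps * B e z) *: e).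
  by rewrite addrC subrK.
set c := _ * B e x; set d := _ * B e y.
have ax : x - c *: e \in a := sub_proj_in x.
have ay : y - d *: e \in a := sub_proj_in y.
have -> : lie e y = lie e (y - d *: e).
  by rewrite lieDr -scaleNr lieZr lie_xx scaler0 addr0.
have -> : lie e x = lie e (x - c *: e).
  by rewrite lieDr -scaleNr lieZr lie_xx scaler0 addr0.
rewrite {1}(split_e x) {1}(split_e y) -/c -/d.
move: (x - _) (y - _) ax ay => x' y' ax ay.
rewrite lieDl !lieDr !lieZl !lieZr lie_xx !scaler0 add0r.
by rewrite (proj2 a_ideal x' y') // addr0 (lieC x') scalerN.
Qed.

Section AssociativeProduct.
Variable U : g -> g -> g.
Hypothesis U_def : LC_symmetric_part B U.

(** In [2 * B (U x y) z] the two terms carrying the e-coordinate of [z] cancel by skewness of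
    [ad_e]; in the other two, skewness moves [ad_e] away from [z]. *)
Lemma LC_symmetric_partE x y :
  U x y = 2^-1 *: ((eps * B e x) *: lie e y + (eps * B e y) *: lie e x).
Proof.
apply: (nondegenerate_ext ndB) => z; have two_neq0 : 2 != 0 :> R by rewrite pnatr_eq0.
apply: (mulfI two_neq0); rewrite U_def symformZl mulVKf //.
rewrite (lie_hyperplane z x) (lie_hyperplane z y) !symformBl symformDl !symformZl.
rewrite !(ad_e_skew z) (ad_e_skew y x) !(symformC B z) (symformC B y (lie e x)).
by ring.
Qed.

(** The triple (x, e, e) suffices for one direction: [U e e] vanishes while [U (U x e) e] is a
    quarter of [lie e (lie e x)]. Conversely, values of [U] have zero e-coordinate and are killed by
    [ad_e], so all triple products vanish. *)
Lemma associative_LC_symmetric_part :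
  associative U <-> forall x, lie e (lie e x) = 0.
Proof.
have e_lie x : B e (lie e x) = 0.
  by apply/eqP; rewrite -oppr_eq0 -ad_e_skew lie_xx symform0l.
have half_neq0 : 2^-1 != 0 :> R by rewrite invr_eq0 pnatr_eq0.
have B_eU x y : B e (U x y) = 0.
  by rewrite LC_symmetric_partE symformZr symformDr !symformZr !e_lie !mulr0 addr0 mulr0.
split=> [Uassoc x|D2 x y z].
  have UxeE z : U z e = 2^-1 *: lie e z.
    by rewrite LC_symmetric_partE lie_xx scaler0 add0r unit_normK scale1r.
  have := Uassoc x e e; rewrite !UxeE lie_xx scaler0 LC_symmetric_partE.
  rewrite lie0r symform0r mulr0 scale0r scaler0 addr0 scaler0 lieZr scalerA.
  by move/esym/eqP; rewrite scaler_eq0 mulf_eq0 (negPf half_neq0) => /eqP.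
have DU u v : lie e (U u v) = 0.
  by rewrite LC_symmetric_partE lieZr lieDr !lieZr !D2 !scaler0 addr0 scaler0.
rewrite (LC_symmetric_partE x) (LC_symmetric_partE (U x y)) !DU !B_eU.
by rewrite !mulr0 !scale0r !scaler0 !addr0 !scaler0.
Qed.

End AssociativeProduct.

End AlmostAbelian.

(** * From a skew map of square zero to the normal form *)

Lemma skew_square_zero_beta (F : fieldType) (V : vectType F) (B : {symmetric V})
    (D : 'End(V)) :
  2 != 0 :> F -> nondegenerate B ->
  (forall x y, B (D x) y = - B x (D y)) -> (forall x, D (D x) = 0) ->
  exists (beta : 'Hom(dual (subvs_of (limg D)), subvs_of (limg D)))
         (phi : 'Hom(TT (subvs_of (limg D)), V)),
    [/\ nondegenerate_bivector beta,
        isometry B (@neutral_form F (subvs_of (limg D))) phi,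
        forall v, D (phi v) = phi (beta_transform beta v)
      & forall x, exists v, D x = phi v].
Proof.
move=> two_neq0 ndB skew D2; set W := subvs_of (limg D).
have D_img x : D x \in limg D by rewrite memv_img ?memvf.
have iso_img : {in limg D &, forall x y, B x y = 0}.
  by move=> _ _ /memv_imgP[x _ ->] /memv_imgP[y _ ->]; rewrite skew D2 symform0r oppr0.
have [phi [iso_phi phiW]] := isotropic_embedding two_neq0 ndB iso_img.
have D_val (w : W) : D (vsval w) = 0.
  by have /memv_imgP[x _ ->] := subvsP w; rewrite D2.
have phiD x : phi (vsproj (limg D) (D x), 0) = D x by rewrite phiW vsprojK.
have [beta betaE] : exists beta : 'Hom(dual W, W),
    beta =1 fun xi => vsproj (limg D) (D (phi (0, xi))).
  apply: linear_lfun => c xi eta.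
  have -> : (0, c *: xi + eta) = c *: (0, xi) + (0, eta) :> TT W.
    by congr (_, _); rewrite /= scaler0 addr0.
  by rewrite !linearP.
(* As [D] kills its own image, only the covector part of [v] contributes. *)
have Dphi v : D (phi v) = phi (beta v.2, 0).
  rewrite betaE phiD; case: v => w xi /=.
  have -> : (w, xi) = (w, 0) + (0, xi) :> TT W.
    by congr (_, _); rewrite /= ?addr0 ?add0r.
  by rewrite linearD linearD /= phiW D_val add0r.
(* Read through the isometry [phi], the bivector identity is the skewness of [D]. *)
have skew_beta : bivector beta.
  move=> xi eta; rewrite -!iso_phi.
  by rewrite -(Dphi (0, eta)) -(Dphi (0, xi)) skew.
exists beta, phi; split=> // [|v|x]; last by exists (vsproj (limg D) (D x), 0);
  rewrite phiD.
  split=> //; apply: lker0_bij; last exact: dim_dual.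
  apply: lker0_trivial => eta beta0; have := Dphi (0, eta); rewrite /= beta0 linear0.
  move=> D0; apply/lfunP => w; rewrite lfunE /=.
  have /memv_imgP[x _ wx] := subvsP w.
  have : eta w + (0 : dual W) 0 = B (phi (w, 0)) (phi (0, eta)) by rewrite iso_phi.
  by rewrite linear0 addr0 phiW wx skew D0 symform0r oppr0.
by rewrite beta_transformE Dphi.
Qed.

Section NormalForm.
Variables (R : realFieldType) (g : lieAlgType R) (B : {symmetric g}).
Variables (a : {vspace g}) (e : g).
Hypotheses (ndB : nondegenerate B) (a_ideal : abelian_ideal a).
Hypotheses (a_codim : codim_one a) (e_gen : <[e]>%VS = orthov B a).
Hypothesis nd_a : nondegenerate (restrict_form B a).
Hypothesis e_unit : B e e = 1 \/ B e e = -1.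
Hypothesis ad_e_skew : forall x y, B (lie e x) y = - B x (lie e y).
Hypothesis ad_e_square : forall x, lie e (lie e x) = 0.

Let eps := B e e.

(** The isomorphism is built backwards: [H] maps the product onto [g] by adding the embeddings [h]
    and [psi] of the two factors, and [f] is its inverse. *)
Lemma normal_form (p q n : nat) :
  has_signature (restrict_form B a) p q -> \dim {:g} = n ->
  exists (k : nat) (W : vectType R) (beta : 'Hom(dual W, W))
         (B1 : {symmetric semidirect (beta_transform beta)})
         (B2 : {symmetric abelian_lie 'rV[R]_(n - 4 * k - 1)}),
    [/\ \dim {:W} = (2 * k)%N /\ (2 * k <= minn p q)%N,
        nondegenerate_bivector beta,
        extends_neutral B1,
        nondegenerate B2
      & exists f : 'Hom(g, (semidirect (beta_transform beta) *
                            abelian_lie 'rV[R]_(n - 4 * k - 1))%type),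
          [/\ bijective f, {morph f : x y / lie x y}
            & isometry (prod_form B1 B2) B f]].
Proof.
move=> sign_a dim_g; have two_neq0 : 2 != 0 :> R by rewrite pnatr_eq0.
have unitK : eps * eps = 1 := unit_normK e_unit.
have memaP x : (x \in a) = (B e x == 0) := mem_hyperplane a_codim e_gen e_unit x.
have lieE := lie_hyperplane a_ideal a_codim e_gen e_unit.
(* The endomorphism [D] is [ad_e] restricted to [a]; the projection [vsproj a] changes nothing
   because [a] is an ideal. *)
have [D DE] : exists D : 'End(subvs_of a), forall x, vsval (D x) = lie e (vsval x).
  have [D DE] : exists D : 'End(subvs_of a), D =1 fun x => vsproj a (lie e (vsval x)).
    by apply: linear_lfun => c x y; rewrite linearP lie_linearr linearP.
  by exists D => x; rewrite DE vsprojK // (proj1 a_ideal) ?subvsP.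
have D_skew x y : restrict_form B a (D x) y = - restrict_form B a x (D y).
  by rewrite /= /restrict_fun !DE ad_e_skew.
have D2 x : D (D x) = 0 by apply: val_inj; rewrite /= !DE ad_e_square.
have [beta [phi [nd_beta iso_phi Dphi imgD]]] :=
  skew_square_zero_beta two_neq0 nd_a D_skew D2.
set W := subvs_of (limg D) in beta phi nd_beta iso_phi Dphi imgD.
have dimW : \dim {:W} = \dim (limg D) by rewrite dimvf.
pose k := (\dim {:W})./2.
have dimWk : \dim {:W} = (2 * k)%N.
  by rewrite mul2n -[LHS]odd_double_half (negPf (nondegenerate_bivector_even nd_beta)).
pose N := semidirect (beta_transform beta).
have [h hE] : exists h : 'Hom(N, g), h =1 fun z => z.1 *: e + vsval (phi z.2).
  apply: linear_lfun => c x y; rewrite linearP linearP /= scalerDl scalerDr scalerA.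
  by rewrite addrACA.
pose B1 : {symmetric N} := pullback_form B h.
have e_phi v : B e (vsval (phi v)) = 0 by apply/eqP; rewrite -memaP subvsP.
have B1E x y : B1 x y = x.1 * y.1 * eps + neutral_form x.2 y.2.
  rewrite /= /pullback_fun !hE symformDl !symformDr !symformZl !symformZr -/eps.
  rewrite [B _ e]symformC !e_phi !mulr0 addr0 add0r mulrA -iso_phi //.
have eps_neq0 : eps != 0 by apply: contra_eq_neq unitK => ->;
  rewrite mulr0 eq_sym oner_eq0.
have ext_B1 : extends_neutral B1.
  split.
  - apply: nondegenerateP => -[s v] B10.
    have s0 : s = 0.
      have := B10 (1, 0); rewrite B1E /neutral_form /= lfunE /= linear0 !addr0 mulr1.
      by move/eqP; rewrite mulf_eq0 (negPf eps_neq0) orbF => /eqP.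
    congr (_, _) => //; apply: (nondegenerate0 (@neutral_form_nondegenerate R W)) => w.
    by have := B10 (0, w); rewrite B1E /= mulr0 mul0r add0r.
  - by rewrite B1E /neutral_form /= lfunE /= addr0 !mul1r addr0.
  - by move=> v; rewrite B1E /neutral_form /= lfunE /= linear0 !addr0 mulr0 mul0r.
  - by move=> u v; rewrite B1E /= mul0r mul0r add0r.
have ndB1 : nondegenerate B1 by case: ext_B1.
pose m := (n - 4 * k - 1)%N; pose M := abelian_lie 'rV[R]_m.
have dimNM : (\dim {:N} + \dim {:M})%N = \dim {:g}.
  have dimN : \dim {:N} = (1 + 4 * k)%N.
    by rewrite !dim_pair dim_dual dimWk dimvf /dim /=; lia.
  have dimM : \dim {:M} = m by rewrite dimvf /dim /= mul1n.
  (* Injectivity of [h] gives [1 + 4 * k <= n], so the truncated subtractions in [m] are exact. *)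
  have := isometry_injective ndB1 (fun x y => erefl (B1 x y)) => h_inj.
  have := dimvS (subvf (limg h)); rewrite limg_dim_eq ?(eqP h_inj) ?capv0 //.
  by rewrite dimN dimM dim_g /m; lia.
have [psi [h_psi bij_H]] :=
  orthogonal_complement ndB1 (fun x y => erefl (B1 x y)) dimNM.
pose B2 : {symmetric M} := pullback_form B psi.
have psi0 t : psi t = 0 -> t = 0.
  move=> t0; have := bij_inj bij_H (x1 := (0, t)) (x2 := (0, 0)).
  by rewrite /= !linear0 t0 => /(_ erefl) [].
have ndB2 : nondegenerate B2.
  apply: nondegenerateP => t B2t0; apply: psi0; apply: (nondegenerate0 ndB) => y.
  have [H' _ HK] := bij_H; rewrite -(HK y) symformDr symformC h_psi add0r.
  exact: B2t0.
have e_psi t : B e (psi t) = 0.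
  rewrite -(h_psi (1, 0) t) hE /= scale1r.
  by rewrite (linear0 phi) /= addr0.
(* By skewness, pairing with [y] amounts to pairing [psi t] with a value of [D], which lies in the
   image of [phi] and is thus orthogonal to [psi t]. *)
have lie_e_psi t : lie e (psi t) = 0.
  apply: (nondegenerate0 ndB) => y; rewrite ad_e_skew.
  have ay := sub_proj_in a_codim e_gen e_unit y.
  have -> : lie e y = lie e (y - (eps * B e y) *: e).
    by rewrite lieDr -scaleNr lieZr lie_xx scaler0 addr0.
  rewrite -(vsprojK ay) -DE; have [v ->] := imgD (vsproj a (y - (eps * B e y) *: e)).
  have := h_psi (0, v) t; rewrite hE /= scale0r add0r symformC => ->.
  by rewrite oppr0.
(* By [lie_hyperplane] a bracket depends only on e-coordinates and on [ad_e], so it suffices to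
   compute these two on the image of the sum map. *)
have lie_H (z w : N * M) : lie (h z.1 + psi z.2) (h w.1 + psi w.2) =
    h (lie z w).1 + psi (lie z w).2.
  have B_eH (x : N * M) : eps * B e (h x.1 + psi x.2) = x.1.1.
    rewrite symformDr e_psi addr0 hE symformDr e_phi addr0 symformZr -/eps.
    by rewrite mulrCA unitK mulr1.
  have lie_eH (x : N * M) :
      lie e (h x.1 + psi x.2) = vsval (phi (beta_transform beta x.1.2)).
    rewrite lieDr lie_e_psi addr0 hE lieDr lieZr lie_xx scaler0 add0r.
    by rewrite -DE Dphi.
  rewrite lieE !B_eH !lie_eH hE /= scale0r add0r linear0 addr0.
  have phi_lin c u d v : phi (c *: u - d *: v) = c *: phi u - d *: phi v.
    by rewrite linearB !linearZ.
  by rewrite [in RHS]phi_lin linearB !linearZ.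
have [H HE] : exists H : 'Hom((N * M)%type, g), H =1 fun z => h z.1 + psi z.2.
  by apply: linear_lfun => s x y; rewrite !linearP scalerDr addrACA.
have {}bij_H : bijective H by apply: (eq_bij bij_H) => z; rewrite HE.
have H_ker0 : lker H == 0%VS by apply/lker0P/bij_inj.
have HK : cancel (H^-1)%VF H.
  by have [H' H'K HK] := bij_H => x; rewrite -{1}(HK x) lker0_lfunK // HK.
exists k, W, beta, B1, B2; split=> //.
  (* The bound on [2 * k] holds because the image of [D] is totally isotropic in [a]. *)
  by rewrite -dimWk dimW; split=> //; apply: isotropic_dim sign_a _;
     move=> _ _ /memv_imgP[x _ ->] /memv_imgP[y _ ->]; rewrite D_skew D2 symform0r oppr0.
exists (H^-1)%VF; split=> [|x y|x y].
- by exists H => // z; apply: lker0_lfunK.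
- apply: (bij_inj bij_H); rewrite HK HE -lie_H -!HE !HK //.
rewrite -{2}(HK x) -{2}(HK y) !HE symformDl !symformDr h_psi addr0.
by rewrite [B (psi _) (h _)]symformC h_psi add0r.
Qed.
End NormalForm.

(** A bracket has zero e-coordinate, and its component in TW lies in the image of the
    beta-transformation, whose square is zero. *)
Lemma product_lie_nilpotent (F : fieldType) (V V' : vectType F) (beta : 'Hom(dual V, V))
    (x y z : (semidirect (beta_transform beta) * abelian_lie V')%type) :
  lie x (lie y z) = 0.
Proof.
apply: (@injective_projections (semidirect _) (abelian_lie V')) => //.
apply: (@injective_projections F (TT V)) => //=.
have D2 v : beta_transform beta (beta_transform beta v) = 0.
  by rewrite !beta_transformE linear0.
by rewrite scale0r subr0 linearB !linearZ /= !D2 oppr0 !scaler0 addr0 scaler0.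
Qed.

Theorem theorem5p2 (R : realType) (g : lieAlgType R) (B : {symmetric g})
    (n p q : nat) (a : {vspace g}) (e : g) (U : g -> g -> g)
    (ndB : nondegenerate B)
    (g_almost_abelian : almost_abelian g)
    (dim_g : \dim {:g} = n)
    (a_abelian_ideal : abelian_ideal a)
    (a_codim : codim_one a)
    (nd_a : nondegenerate (restrict_form B a))
    (sign_a : has_signature (restrict_form B a) p q)
    (e_gen : <[e]>%VS = orthov B a)
    (e_unit : B e e = 1 \/ B e e = -1)
    (ad_e_skew : forall x y, B (lie e x) y = - B x (lie e y))
    (U_def : LC_symmetric_part B U) :
  associative U <->
  exists (k : nat) (W : vectType R) (beta : 'Hom(dual W, W))
         (B1 : {symmetric semidirect (beta_transform beta)})
         (B2 : {symmetric abelian_lie 'rV[R]_(n - 4 * k - 1)}),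
    [/\ \dim {:W} = (2 * k)%N /\ (2 * k <= minn p q)%N,
        nondegenerate_bivector beta,
        extends_neutral B1,
        nondegenerate B2 /\
        (exists s t : nat,
           has_signature B s t /\ has_signature (prod_form B1 B2) s t)
      & isometrically_isomorphic B (prod_form B1 B2)].
Proof.
rewrite (associative_LC_symmetric_part ndB a_abelian_ideal a_codim e_gen e_unit
  ad_e_skew U_def).
split=> [D2 | [k [W [beta [B1 [B2 [_ _ _ _ [f [bij_f lie_f _]]]]]]]] x].
  have [k [W [beta [B1 [B2 [dimW nd_beta ext_B1 ndB2 [f [bij_f lie_f iso_f]]]]]]]] :=
    normal_form ndB a_abelian_ideal a_codim e_gen nd_a e_unit ad_e_skew D2 sign_a dim_g.
  exists k, W, beta, B1, B2; split=> //; last by exists f.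
  split=> //; have e_orth : e \in orthov B a by rewrite -e_gen memv_line.
  have [s [t sign_B]] := has_signature_codim_one sign_a a_codim e_orth e_unit.
  by exists s, t; split=> //; apply: has_signature_isometry bij_f iso_f sign_B.
(* The isomorphism sends [lie e (lie e x)] to a double bracket of the product, which vanishes. *)
by apply: (bij_inj bij_f); rewrite !lie_f product_lie_nilpotent linear0.
Qed.
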